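(* Let $(\mathcal{A},\mu,\Delta,(\alpha_i)_{i=1,2})$ be a finite-dimensional weak totally hom-associative ternary infinitesimal bialgebra over a field $\mathcal{K}$ of characteristic zero. Then $(\mathcal{A}^*,\Delta^*,\mu^*,(\alpha_i^* )_{i=1,2})$ is a weak totally hom-associative ternary infinitesimal bialgebra (with ternary product $\Delta^*$, ternary coproduct $\mu^*$ and twisting maps $\alpha_1^*,\alpha_2^*$).
   Context: A weak totally hom-associative ternary infinitesimal bialgebra $(\mathcal{A},\mu,\Delta,(\alpha_i)_{i=1,2})$ is a vector space $\mathcal{A}$ with linear maps $\mu:\mathcal{A}^{\otimes3}\to\mathcal{A}$, $\Delta:\mathcal{A}\to\mathcal{A}^{\otimes3}$, $\alpha_1,\alpha_2:\mathcal{A}\to\mathcal{A}$ such that: (1) $(\mathcal{A},\mu,(\alpha_i))$ is a weak totally hom-associative ternary algebra: for all $x_1,\dots,x_5\in\mathcal{A}$, $\mu(\mu(x_1,x_2,x_3),\alpha_1(x_4),\alpha_2(x_5))=\mu(\alpha_1(x_1),\alpha_2(x_2),\mu(x_3,x_4,x_5))$; (2) $(\mathcal{A},\Delta,(\alpha_i))$ is a weak totally hom-coassociative ternary coalgebra: $(\Delta\otimes\alpha_1\otimes\alpha_2)\circ\Delta=(\alpha_1\otimes\alpha_2\otimes\Delta)\circ\Delta$; (3) for all $x,y,z\in\mathcal{A}$, $$\Delta\mu(x,y,z)=(L_\mu(\alpha_1(x),\alpha_2(y))\otimes\alpha_1\otimes\alpha_2)\Delta(z)+(\alpha_1\otimes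 M_\mu(\alpha_1(x),\alpha_2(z))\otimes\alpha_2)\Delta(y)+(\alpha_1\otimes\alpha_2\otimes R_\mu(\alpha_1(y),\alpha_2(z)))\Delta(x),$$ where $L_\mu(x,y)(z)=\mu(x,y,z)$, $R_\mu(x,y)(z)=\mu(z,x,y)$, $M_\mu(x,y)(z)=\mu(x,z,y)$. Dual maps: with $\langle\xi,x\rangle=\xi(x)$ and $\langle\xi\otimes\eta\otimes\gamma,x\otimes y\otimes z\rangle=\langle\xi,x\rangle\langle\eta,y\rangle\langle\gamma,z\rangle$, put $\langle\alpha^*(f),x\rangle=\langle f,\alpha(x)\rangle$, $\langle\Delta^*(\xi,\eta,\gamma),x\rangle=\langle\xi\otimes\eta\otimes\gamma,\Delta(x)\rangle$ and $\langle\mu^*(\xi),x\otimes y\otimes z\rangle=\langle\xi,\mu(x,y,z)\rangle$. *)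

(* Defs.v *)
From HB Require Import structures.
From mathcomp Require Import all_boot all_order all_algebra.

Set Implicit Arguments.
Unset Strict Implicit.
Unset Printing Implicit Defensive.

Import GRing.Theory.
Import VectorInternalTheory.
Local Open Scope ring_scope.

(* [tens U V], the tensor product of finite-dimensional spaces, is modelled by
   the matrices of coordinates with respect to the bases of [U] and [V] given
   by [v2r]; its universal property is [pure_bilin], [tens_lift_pure],
   [tens_ext] and [tens_lift_bilinear].  Every map out of a tensor product is
   defined through [tens_lift], that is, by its values on pure tensors. *)

Definition tens (K : fieldType) (U V : vectType K) : vectType K :=
  'M[K]_(dim U, dim V).
Arguments tens : simpl never.

Definition pure (K : fieldType) (U V : vectType K) (u : U) (v : V) :
    tens U V :=
  (v2r u)^T *m v2r v.
Arguments pure : simpl never.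

Definition e_ (K : fieldType) (U : vectType K) (i : 'I_(dim U)) : U :=
  r2v (delta_mx 0 i).

(* Only meaningful for a bilinear [b]. *)
Definition tens_lift (K : fieldType) (U V W : vectType K) (b : U -> V -> W) :
    'Hom(tens U V, W) :=
  linfun (fun T : 'M[K]_(dim U, dim V) =>
            \sum_i \sum_j T i j *: b (e_ i) (e_ j)).

Definition bilin (K : fieldType) (U V W : vectType K) (b : U -> V -> W) :=
  bilinear_for *:%R *:%R b.

Lemma tens_lift_linear (K : fieldType) (U V W : vectType K) (b : U -> V -> W) :
  linear (fun T : 'M[K]_(dim U, dim V) =>
            \sum_i \sum_j T i j *: b (e_ i) (e_ j)).
Proof.
move=> a S T; rewrite scaler_sumr -big_split /=; apply: eq_bigr => i _.
rewrite scaler_sumr -big_split /=; apply: eq_bigr => j _.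
by rewrite !mxE scalerDl scalerA.
Qed.

Lemma linfun_linE (K : fieldType) (U V : vectType K) (f : U -> V) :
  linear f -> linfun f =1 f.
Proof.
move=> lf.
pose L := GRing.isLinear.Build K U V *:%R f lf.
pose F : {linear U -> V} := HB.pack f L.
exact: (lfunE F).
Qed.

Lemma tens_liftE (K : fieldType) (U V W : vectType K) (b : U -> V -> W)
    (T : 'M[K]_(dim U, dim V)) :
  tens_lift b T = \sum_i \sum_j T i j *: b (e_ i) (e_ j).
Proof. exact: (linfun_linE (@tens_lift_linear K U V W b)). Qed.

Lemma sum_e (K : fieldType) (U : vectType K) (u : U) :
  u = \sum_i v2r u 0 i *: e_ i.
Proof.
rewrite -[LHS]v2rK {1}[v2r u]row_sum_delta linear_sum /=.
by apply: eq_bigr => i _; rewrite linearZ.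
Qed.

Lemma linear_sumZ (K : fieldType) (U V : vectType K) (f : U -> V) (I : finType)
    (c : I -> K) (x : I -> U) :
  linear f -> f (\sum_i c i *: x i) = \sum_i c i *: f (x i).
Proof.
move=> lf; rewrite -(linfun_linE lf) linear_sum; apply: eq_bigr => i _.
by rewrite linearZ /= linfun_linE.
Qed.

Lemma pureE (K : fieldType) (U V : vectType K) (u : U) (v : V) i j :
  (pure u v : 'M[K]_(dim U, dim V)) i j = v2r u 0 i * v2r v 0 j.
Proof. by rewrite mxE big_ord1 mxE. Qed.

Lemma tensPE (K : fieldType) (U V : vectType K) (a : K) (S T : tens U V) i j :
  (a *: S + T : 'M[K]_(dim U, dim V)) i j
  = a * (S : 'M[K]_(dim U, dim V)) i j + (T : 'M[K]_(dim U, dim V)) i j.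
Proof. by rewrite /tens in S T *; rewrite !mxE. Qed.

Lemma pure_bilin (K : fieldType) (U V : vectType K) : bilin (@pure K U V).
Proof.
split=> [v a u u'|u a v v']; apply/matrixP=> i j;
  rewrite tensPE !pureE linearP !mxE.
  by rewrite mulrDl mulrA.
by rewrite mulrDr mulrCA.
Qed.

Lemma purePl (K : fieldType) (U V : vectType K) (a : K) (u u' : U) (v : V) :
  pure (a *: u + u') v = a *: pure u v + pure u' v.
Proof. exact: (pure_bilin U V).1. Qed.

Lemma purePr (K : fieldType) (U V : vectType K) (a : K) (u : U) (v v' : V) :
  pure u (a *: v + v') = a *: pure u v + pure u v'.
Proof. exact: (pure_bilin U V).2. Qed.

Lemma tens_lift_pure (K : fieldType) (U V W : vectType K) (b : U -> V -> W) :
  bilin b -> forall u v, tens_lift b (pure u v) = b u v.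
Proof.
move=> [b1 b2] u v; rewrite tens_liftE.
rewrite [in RHS](sum_e u) (@linear_sumZ K U W (b^~ v)); last exact: b1.
apply: eq_bigr => i _; rewrite [in RHS](sum_e v) linear_sumZ; last exact: b2.
rewrite scaler_sumr; apply: eq_bigr => j _.
by rewrite pureE scalerA.
Qed.

Lemma sum_pure (K : fieldType) (U V : vectType K) (T : tens U V) :
  T = \sum_i \sum_j (T : 'M[K]_(dim U, dim V)) i j *: pure (e_ i) (e_ j).
Proof.
rewrite [LHS](matrix_sum_delta (T : 'M[K]_(dim U, dim V))).
apply: eq_bigr => i _; apply: eq_bigr => j _; congr (_ *: _).
apply/matrixP=> k l; rewrite pureE /e_ !r2vK !mxE !eqxx /=.
by rewrite -natrM mulnb.
Qed.

Lemma tens_ext (K : fieldType) (U V W : vectType K) (f g : 'Hom(tens U V, W)) :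
  (forall u v, f (pure u v) = g (pure u v)) -> f = g.
Proof.
move=> fg; apply/lfunP=> T; rewrite (sum_pure T) !linear_sum.
apply: eq_bigr => i _; rewrite !linear_sum; apply: eq_bigr => j _.
by rewrite !linearZ /= fg.
Qed.

Lemma tens_lift_bilinear (K : fieldType) (U V W : vectType K)
    (f : 'Hom(tens U V, W)) :
  bilin (fun u v => f (pure u v)).
Proof.
by split=> [v a u u'|u a v v'] /=; rewrite ?purePl ?purePr linearP.
Qed.

Definition tens_map (K : fieldType) (U U' V V' : vectType K)
    (f : 'Hom(U, U')) (g : 'Hom(V, V')) : 'Hom(tens U V, tens U' V') :=
  tens_lift (fun u v => pure (f u) (g v)).

Lemma tens_map_pure (K : fieldType) (U U' V V' : vectType K)
    (f : 'Hom(U, U')) (g : 'Hom(V, V')) u v :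
  tens_map f g (pure u v) = pure (f u) (g v).
Proof.
apply: tens_lift_pure.
by split=> [{}v a {}u u'|{}u a {}v v'] /=; rewrite linearP ?purePl ?purePr.
Qed.

Definition tens_assoc (K : fieldType) (U V W : vectType K) :
    'Hom(tens (tens U V) W, tens U (tens V W)) :=
  tens_lift (fun (T : tens U V) (w : W) =>
    tens_lift (fun u v => pure u (pure v w)) T).

Lemma tens_assoc_pure (K : fieldType) (U V W : vectType K) u v w :
  @tens_assoc K U V W (pure (pure u v) w) = pure u (pure v w).
Proof.
have bil x : bilin (fun (u : U) (v : V) => pure u (pure v x)).
  split=> [v' a u1 u2|u' a v1 v2] /=; first by rewrite purePl.
  by rewrite purePl purePr.
rewrite /tens_assoc tens_lift_pure ?tens_lift_pure //.
split=> [x a S T|T a x y] /=; first by rewrite linearP.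
rewrite !tens_liftE scaler_sumr -big_split; apply: eq_bigr => i _ /=.
rewrite scaler_sumr -big_split; apply: eq_bigr => j _ /=.
by rewrite !purePr scalerDr !scalerA mulrC.
Qed.

Definition tens3 (K : fieldType) (U V W : vectType K) : vectType K :=
  tens U (tens V W).

Definition pure3 (K : fieldType) (U V W : vectType K) (u : U) (v : V) (w : W) :
    tens3 U V W :=
  pure u (pure v w).

Definition tens_map3 (K : fieldType) (U U' V V' W W' : vectType K)
    (f : 'Hom(U, U')) (g : 'Hom(V, V')) (h : 'Hom(W, W')) :
    'Hom(tens3 U V W, tens3 U' V' W') :=
  tens_map f (tens_map g h).

Lemma tens_map3_pure (K : fieldType) (U U' V V' W W' : vectType K)
    (f : 'Hom(U, U')) (g : 'Hom(V, V')) (h : 'Hom(W, W')) u v w :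
  tens_map3 f g h (pure3 u v w) = pure3 (f u) (g v) (h w).
Proof. by rewrite /tens_map3 /pure3 !tens_map_pure. Qed.

(* (U (x) V (x) W) (x) X (x) Y = U (x) V (x) (W (x) X (x) Y); both
   sides of the hom-coassociativity axiom live in the fifth tensor power only
   up to this rebracketing. *)
Definition tens3_assoc (K : fieldType) (U V W X Y : vectType K) :
    'Hom(tens3 (tens3 U V W) X Y, tens3 U V (tens3 W X Y)) :=
  (tens_map \1 (@tens_assoc K V W (tens X Y))
     \o @tens_assoc K U (tens V W) (tens X Y))%VF.

Lemma tens3_assoc_pure (K : fieldType) (U V W X Y : vectType K) u v w x y :
  @tens3_assoc K U V W X Y (pure3 (pure3 u v w) x y)
  = pure3 u v (pure3 w x y).
Proof.
by rewrite /tens3_assoc /pure3 comp_lfunE tens_assoc_pure tens_map_pure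
           tens_assoc_pure id_lfunE.
Qed.

Definition ternL (K : fieldType) (A : vectType K) (mu : 'Hom(tens3 A A A, A))
    (x y : A) : 'End(A) :=
  linfun (fun z => mu (pure3 x y z)).
Definition ternR (K : fieldType) (A : vectType K) (mu : 'Hom(tens3 A A A, A))
    (x y : A) : 'End(A) :=
  linfun (fun z => mu (pure3 z x y)).
Definition ternM (K : fieldType) (A : vectType K) (mu : 'Hom(tens3 A A A, A))
    (x y : A) : 'End(A) :=
  linfun (fun z => mu (pure3 x z y)).

Lemma ternLE (K : fieldType) (A : vectType K) (mu : 'Hom(tens3 A A A, A))
    (x y z : A) :
  ternL mu x y z = mu (pure3 x y z).
Proof.
apply: linfun_linE => a u v; rewrite /pure3.
by rewrite !purePr linearP.
Qed.

Lemma ternRE (K : fieldType) (A : vectType K) (mu : 'Hom(tens3 A A A, A))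
    (x y z : A) :
  ternR mu x y z = mu (pure3 z x y).
Proof.
apply: linfun_linE => a u v; rewrite /pure3.
by rewrite purePl linearP.
Qed.

Lemma ternME (K : fieldType) (A : vectType K) (mu : 'Hom(tens3 A A A, A))
    (x y z : A) :
  ternM mu x y z = mu (pure3 x z y).
Proof.
apply: linfun_linE => a u v; rewrite /pure3.
by rewrite purePl purePr linearP.
Qed.

Definition weak_tot_hom_assoc (K : fieldType) (A : vectType K)
    (mu : 'Hom(tens3 A A A, A)) (alpha1 alpha2 : 'End(A)) : Prop :=
  forall x1 x2 x3 x4 x5 : A,
    mu (pure3 (mu (pure3 x1 x2 x3)) (alpha1 x4) (alpha2 x5))
    = mu (pure3 (alpha1 x1) (alpha2 x2) (mu (pure3 x3 x4 x5))).

Definition weak_tot_hom_coassoc (K : fieldType) (A : vectType K)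
    (Delta : 'Hom(A, tens3 A A A)) (alpha1 alpha2 : 'End(A)) : Prop :=
  (tens3_assoc A A A A A \o (tens_map3 Delta alpha1 alpha2 \o Delta))%VF
  = (tens_map3 alpha1 alpha2 Delta \o Delta)%VF.

Definition inf_compat (K : fieldType) (A : vectType K)
    (mu : 'Hom(tens3 A A A, A)) (Delta : 'Hom(A, tens3 A A A))
    (alpha1 alpha2 : 'End(A)) : Prop :=
  forall x y z : A,
    Delta (mu (pure3 x y z))
    = tens_map3 (ternL mu (alpha1 x) (alpha2 y)) alpha1 alpha2 (Delta z)
    + tens_map3 alpha1 (ternM mu (alpha1 x) (alpha2 z)) alpha2 (Delta y)
    + tens_map3 alpha1 alpha2 (ternR mu (alpha1 y) (alpha2 z)) (Delta x).

Record weak_tot_hom_assoc_inf_bialg (K : fieldType) (A : vectType K)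
    (mu : 'Hom(tens3 A A A, A)) (Delta : 'Hom(A, tens3 A A A))
    (alpha1 alpha2 : 'End(A)) : Prop := WeakTotHomAssocInfBialg {
  bialg_assoc : weak_tot_hom_assoc mu alpha1 alpha2;
  bialg_coassoc : weak_tot_hom_coassoc Delta alpha1 alpha2;
  bialg_compat : inf_compat mu Delta alpha1 alpha2
}.

Definition dual (K : fieldType) (V : vectType K) : vectType K := 'Hom(V, K^o).
Arguments dual : simpl never.

Definition pairing (K : fieldType) (V : vectType K) (xi : dual V) (x : V) : K :=
  (xi : 'Hom(V, K^o)) x.

Definition dual_map (K : fieldType) (V W : vectType K) (f : 'Hom(V, W)) :
    'Hom(dual W, dual V) :=
  linfun (fun xi : 'Hom(W, K^o) => (xi \o f)%VF : dual V).

Lemma pairingP (K : fieldType) (V : vectType K) (xi : dual V) a x y :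
  pairing xi (a *: x + y) = a * pairing xi x + pairing xi y.
Proof. by rewrite /pairing linearP. Qed.

Lemma pairingPl (K : fieldType) (V : vectType K) (xi eta : dual V) a x :
  pairing (a *: xi + eta) x = a * pairing xi x + pairing eta x.
Proof.
by rewrite /dual in xi eta *; rewrite /pairing add_lfunE scale_lfunE.
Qed.

Lemma dual_ext (K : fieldType) (V : vectType K) (xi eta : dual V) :
  (forall x, pairing xi x = pairing eta x) -> xi = eta.
Proof. by move=> H; apply/lfunP. Qed.

Lemma dual_mapE (K : fieldType) (V W : vectType K) (f : 'Hom(V, W)) xi x :
  pairing (dual_map f xi) x = pairing xi (f x).
Proof.
have cE z y : pairing ((z : 'Hom(W, K^o)) \o f)%VF y = pairing z (f y).
  by rewrite /pairing comp_lfunE.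
rewrite /dual_map linfun_linE ?cE // => a u v.
by apply: dual_ext => y; rewrite pairingPl !cE pairingPl.
Qed.

(* The pairing of V* (x) W* with V (x) W, curried as a map to (V (x) W)*; the
   same for three factors in [dual_tens3].  See [dual_tens_pure] and
   [dual_tens3_pure]. *)
Definition dual_tens (K : fieldType) (V W : vectType K) :
    'Hom(tens (dual V) (dual W), dual (tens V W)) :=
  tens_lift (fun (xi : dual V) (eta : dual W) =>
    tens_lift (fun v w => pairing xi v * pairing eta w : K^o) : dual (tens V W)).

Definition dual_tens3 (K : fieldType) (U V W : vectType K) :
    'Hom(tens3 (dual U) (dual V) (dual W), dual (tens3 U V W)) :=
  (dual_tens U (tens V W) \o tens_map \1 (dual_tens V W))%VF.

Lemma pairing_bilin (K : fieldType) (V W : vectType K) (xi : dual V)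
    (eta : dual W) :
  bilin (fun v w => pairing xi v * pairing eta w : K^o).
Proof.
split=> [w a v v'|v a w w'] /=; rewrite pairingP.
  by rewrite mulrDl -mulrA.
by rewrite mulrDr mulrCA.
Qed.

Lemma dual_tens_ext (K : fieldType) (V W : vectType K)
    (phi psi : dual (tens V W)) :
  (forall v w, pairing phi (pure v w) = pairing psi (pure v w)) -> phi = psi.
Proof. exact: (@tens_ext K V W K^o phi psi). Qed.

Lemma dual_tens_pure (K : fieldType) (V W : vectType K) xi eta v w :
  pairing (dual_tens V W (pure xi eta)) (pure v w)
  = pairing xi v * pairing eta w.
Proof.
pose b (xi : dual V) (eta : dual W) : dual (tens V W) :=
  tens_lift (fun v w => pairing xi v * pairing eta w : K^o).
have bE f g x y : pairing (b f g) (pure x y) = pairing f x * pairing g y.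
  by rewrite {1}/pairing /b tens_lift_pure //; apply: pairing_bilin.
rewrite /dual_tens (tens_lift_pure (b := b)) ?bE //.
split=> [g a f f'|f a g g'] /=; apply: dual_tens_ext => x y.
  by rewrite pairingPl !bE pairingPl mulrDl -mulrA.
by rewrite pairingPl !bE pairingPl mulrDr mulrCA.
Qed.

Lemma dual_tens3_pure (K : fieldType) (U V W : vectType K) xi eta gamma u v w :
  pairing (dual_tens3 U V W (pure3 xi eta gamma)) (pure3 u v w)
  = pairing xi u * pairing eta v * pairing gamma w.
Proof.
by rewrite /dual_tens3 /pure3 comp_lfunE tens_map_pure id_lfunE !dual_tens_pure
           mulrA.
Qed.

Definition dual_e (K : fieldType) (V : vectType K) (i : 'I_(dim V)) : dual V :=
  linfun (fun v : V => v2r v 0 i : K^o).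

Lemma dual_eE (K : fieldType) (V : vectType K) (i : 'I_(dim V)) v :
  pairing (dual_e i) v = v2r v 0 i.
Proof.
by rewrite /pairing linfun_linE // => a x y; rewrite linearP !mxE.
Qed.

Lemma pairing_suml (K : fieldType) (V : vectType K) (I : finType) (c : I -> K)
    (xi : I -> dual V) x :
  pairing (\sum_i c i *: xi i) x = \sum_i c i * pairing (xi i) x.
Proof.
pose g (xi : dual V) : K^o := pairing xi x.
apply: (@linear_sumZ K _ _ g) => a f f'; exact: pairingPl.
Qed.

Lemma pairing_sum (K : fieldType) (V : vectType K) (I : finType) (c : I -> K)
    (xi : dual V) (x : I -> V) :
  pairing xi (\sum_i c i *: x i) = \sum_i c i * pairing xi (x i).
Proof.
pose g (x : V) : K^o := pairing xi x.
apply: (@linear_sumZ K _ _ g) => a f f'; exact: pairingP.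
Qed.

Lemma sum_dual_e (K : fieldType) (V : vectType K) (xi : dual V) :
  xi = \sum_i pairing xi (e_ i) *: dual_e i.
Proof.
apply: dual_ext => v; rewrite pairing_suml {1}(sum_e v) pairing_sum.
by apply: eq_bigr => i _; rewrite dual_eE mulrC.
Qed.

Lemma dual_tens_inj (K : fieldType) (V W : vectType K) :
  injective (dual_tens V W).
Proof.
pose inv (phi : dual (tens V W)) : tens (dual V) (dual W) :=
  \sum_i \sum_j pairing phi (pure (e_ i) (e_ j)) *: pure (dual_e i) (dual_e j).
have invl : linear inv.
  move=> a f g; rewrite scaler_sumr -big_split; apply: eq_bigr => i _ /=.
  rewrite scaler_sumr -big_split; apply: eq_bigr => j _ /=.
  by rewrite pairingPl scalerDl scalerA.
have invK : (linfun inv \o dual_tens V W)%VF = \1%VF.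
  apply: tens_ext => f g; rewrite id_lfunE comp_lfunE linfun_linE // /inv.
  rewrite [in RHS](sum_dual_e f).
  rewrite (@linear_sumZ K (dual V) _ (fun f => pure f g)); last first.
    by move=> a x y; rewrite purePl.
  apply: eq_bigr => i _; rewrite [in RHS](sum_dual_e g).
  rewrite (@linear_sumZ K (dual W) _ (fun g => pure (dual_e i) g)); last first.
    by move=> a x y; rewrite purePr.
  rewrite scaler_sumr; apply: eq_bigr => j _.
  by rewrite dual_tens_pure scalerA.
apply: (can_inj (g := linfun inv)) => T.
by rewrite -comp_lfunE invK id_lfunE.
Qed.

Lemma dim_dual (K : fieldType) (V : vectType K) : dim (dual V) = dim V.
Proof. exact: muln1. Qed.

Lemma dim_tens (K : fieldType) (V W : vectType K) :
  dim (tens V W) = (dim V * dim W)%N.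
Proof. by []. Qed.

Lemma inj_dim_surj (K : fieldType) (V W : vectType K) (f : 'Hom(V, W)) :
  injective f -> dim V = dim W -> cancel f^-1%VF f.
Proof.
move=> /lker0P/eqP kf dVW w; apply: limg_lfunVK.
suff -> : limg f = fullv by apply: memvf.
by apply/eqP; rewrite eqEdim subvf limg_dim_eq ?kf ?capv0 // !dimvf dVW leqnn.
Qed.

Lemma dual_tensVK (K : fieldType) (V W : vectType K) :
  cancel (dual_tens V W)^-1%VF (dual_tens V W).
Proof.
by apply: inj_dim_surj; [apply: dual_tens_inj | rewrite dim_dual !dim_tens !dim_dual].
Qed.

Lemma dual_tens3_inj (K : fieldType) (U V W : vectType K) :
  injective (dual_tens3 U V W).
Proof.
pose f : 'Hom(tens (dual U) (tens (dual V) (dual W)), _) :=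
  tens_map \1 (dual_tens V W).
pose g : 'Hom(_, tens (dual U) (tens (dual V) (dual W))) :=
  tens_map \1 (dual_tens V W)^-1.
have gf : (g \o f)%VF = \1%VF.
  apply: tens_ext => xi T; rewrite comp_lfunE !tens_map_pure !id_lfunE.
  by rewrite lker0_lfunK //; apply/lker0P/dual_tens_inj.
have fK : cancel f g by move=> T; rewrite -comp_lfunE gf id_lfunE.
move=> S T; rewrite /dual_tens3 !comp_lfunE => /dual_tens_inj.
exact: (can_inj fK).
Qed.

Lemma dual_tens3VK (K : fieldType) (U V W : vectType K) :
  cancel (dual_tens3 U V W)^-1%VF (dual_tens3 U V W).
Proof.
by apply: inj_dim_surj; [apply: dual_tens3_inj | rewrite dim_dual !dim_tens !dim_dual].
Qed.

(* Delta^*, restricted along A* (x) A* (x) A* -> (A (x) A (x) A)*. *)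
Definition dual_comul (K : fieldType) (A : vectType K)
    (Delta : 'Hom(A, tens3 A A A)) :
    'Hom(tens3 (dual A) (dual A) (dual A), dual A) :=
  (dual_map Delta \o dual_tens3 A A A)%VF.

(* mu^*; its values lie in A* (x) A* (x) A* because [dual_tens3] is bijective
   in finite dimension. *)
Definition dual_mul (K : fieldType) (A : vectType K)
    (mu : 'Hom(tens3 A A A, A)) :
    'Hom(dual A, tens3 (dual A) (dual A) (dual A)) :=
  ((dual_tens3 A A A)^-1 \o dual_map mu)%VF.

Lemma dual_comulE (K : fieldType) (A : vectType K)
    (Delta : 'Hom(A, tens3 A A A)) (xi eta gamma : dual A) (x : A) :
  pairing (dual_comul Delta (pure3 xi eta gamma)) x
  = pairing (dual_tens3 A A A (pure3 xi eta gamma)) (Delta x).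
Proof. by rewrite /dual_comul comp_lfunE dual_mapE. Qed.

Lemma dual_mulE (K : fieldType) (A : vectType K)
    (mu : 'Hom(tens3 A A A, A)) (xi : dual A) (x y z : A) :
  pairing (dual_tens3 A A A (dual_mul mu xi)) (pure3 x y z)
  = pairing xi (mu (pure3 x y z)).
Proof.
have -> : dual_mul mu xi = (dual_tens3 A A A)^-1%VF (dual_map mu xi).
  by rewrite /dual_mul comp_lfunE.
by rewrite dual_tens3VK dual_mapE.
Qed.

(* Main.v *)
Require Import Defs.
From mathcomp Require Import all_boot all_order all_algebra.
Import GRing.Theory.
Local Open Scope ring_scope.

(** Here [A'] denotes the dual of [A] and [f'] the transpose of a map [f].
    Over a finite-dimensional space, the pairing of [A'] with [A] turns every
    axiom for the dual structure into an axiom for the original one, read after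
    transposition.  Hom-associativity of [Delta'] is the transpose of
    hom-coassociativity of [Delta], and hom-coassociativity of [mu'] is the
    transpose of hom-associativity of [mu].  The compatibility axiom is its own
    transpose: both sides are tested on [xi (x) eta (x) gamma] and
    [x (x) y (x) z]; the [M]-term is then self-dual, while the [L]-term of
    either structure is the [R]-term of the other.

    Two facts carry the proof.  The embedding
    [dual_tens3 : A' (x) A' (x) A' -> (A (x) A (x) A)'] is natural
    ([dual_tens3_map]), also with respect to rebracketing of fivefold products
    ([pairing5_assoc]); this settles associativity and coassociativity.
    For compatibility, each translation [L], [M], [R] of the ternary product
    [Delta'] is itself the transpose of an endomorphism of [A], because a
    finite-dimensional space is reflexive ([dual_map_surj]).  Hence naturality
    applies once more, and no contraction of tensors has to be written out. *)

(** * Maps out of threefold and fivefold tensor products *)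

Lemma tens3_ext {K : fieldType} {U V W X : vectType K}
    (f g : 'Hom(tens3 U V W, X)) :
  (forall u v w, f (pure3 u v w) = g (pure3 u v w)) -> f = g.
Proof.
move=> fg; apply: tens_ext => u T.
pose F (h : 'Hom(tens3 U V W, X)) : 'Hom(tens V W, X) :=
  linfun (fun S => h (pure u S)).
have FE h S : F h S = h (pure u S).
  by apply: linfun_linE => a x y; rewrite purePr linearP.
rewrite -!FE; congr (fun_of_lfun _ T); apply: tens_ext => v w.
by rewrite !FE; apply: fg.
Qed.

Lemma tens5_ext {K : fieldType} {U V W X Y Z : vectType K}
    (f g : 'Hom(tens3 (tens3 U V W) X Y, Z)) :
  (forall u v w x y,
     f (pure3 (pure3 u v w) x y) = g (pure3 (pure3 u v w) x y)) -> f = g.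
Proof.
move=> fg; apply: tens3_ext => T x y.
pose F (h : 'Hom(tens3 (tens3 U V W) X Y, Z)) : 'Hom(tens3 U V W, Z) :=
  linfun (fun S => h (pure3 S x y)).
have FE h S : F h S = h (pure3 S x y).
  by apply: linfun_linE => a s t; rewrite /pure3 purePl linearP.
rewrite -!FE; congr (fun_of_lfun _ T); apply: tens3_ext => u v w.
by rewrite !FE.
Qed.

Lemma tens_map3_comp {K : fieldType} {U U1 U2 V V1 V2 W W1 W2 : vectType K}
    (f : 'Hom(U, U1)) (g : 'Hom(V, V1)) (h : 'Hom(W, W1))
    (f1 : 'Hom(U1, U2)) (g1 : 'Hom(V1, V2)) (h1 : 'Hom(W1, W2)) T :
  tens_map3 f1 g1 h1 (tens_map3 f g h T)
  = tens_map3 (f1 \o f) (g1 \o g) (h1 \o h) T.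
Proof.
rewrite -comp_lfunE; congr (fun_of_lfun _ T); apply: tens3_ext => u v w.
by rewrite comp_lfunE !tens_map3_pure !comp_lfunE.
Qed.

Lemma tens_map3_id {K : fieldType} {U V W : vectType K} (T : tens3 U V W) :
  tens_map3 \1%VF \1%VF \1%VF T = T.
Proof.
rewrite -[RHS]id_lfunE; congr (fun_of_lfun _ T); apply: tens3_ext => u v w.
by rewrite tens_map3_pure !id_lfunE.
Qed.

(** * Naturality of the pairing between tensors and dual tensors *)

Lemma dual_tens3_ext {K : fieldType} {U V W : vectType K}
    (phi psi : dual (tens3 U V W)) :
  (forall u v w, pairing phi (pure3 u v w) = pairing psi (pure3 u v w)) ->
  phi = psi.
Proof. exact: (@tens3_ext K U V W K^o phi psi). Qed.

Lemma dual_tens5_ext {K : fieldType} {U V W X Y : vectType K}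
    (phi psi : dual (tens3 (tens3 U V W) X Y)) :
  (forall u v w x y, pairing phi (pure3 (pure3 u v w) x y)
                     = pairing psi (pure3 (pure3 u v w) x y)) ->
  phi = psi.
Proof. exact: (@tens5_ext K U V W X Y K^o phi psi). Qed.

Lemma dual_tens3_map {K : fieldType} {U U1 V V1 W W1 : vectType K}
    (f : 'Hom(U, U1)) (g : 'Hom(V, V1)) (h : 'Hom(W, W1))
    (T : tens3 (dual U1) (dual V1) (dual W1)) :
  dual_tens3 U V W (tens_map3 (dual_map f) (dual_map g) (dual_map h) T)
  = dual_map (tens_map3 f g h) (dual_tens3 U1 V1 W1 T).
Proof.
rewrite -!comp_lfunE; congr (fun_of_lfun _ T).
apply: tens3_ext => xi eta gamma.
(* [dual_tens3] is itself a composite: naming the outer map keeps it folded. *)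
rewrite (comp_lfunE (dual_tens3 _ _ _)) (comp_lfunE (dual_map _)).
rewrite tens_map3_pure.
apply: dual_tens3_ext => u v w.
by rewrite dual_mapE tens_map3_pure !dual_tens3_pure !dual_mapE.
Qed.

(** Iterated versions of [dual_tens3], one for each bracketing of the fivefold
    products in which the two sides of (co)associativity live. *)
Definition dual_tens5l (K : fieldType) (U V W X Y : vectType K) :
    'Hom(tens3 (tens3 (dual U) (dual V) (dual W)) (dual X) (dual Y),
         dual (tens3 (tens3 U V W) X Y)) :=
  (dual_tens3 (tens3 U V W) X Y \o tens_map3 (dual_tens3 U V W) \1 \1)%VF.

Definition dual_tens5r (K : fieldType) (U V W X Y : vectType K) :
    'Hom(tens3 (dual U) (dual V) (tens3 (dual W) (dual X) (dual Y)),
         dual (tens3 U V (tens3 W X Y))) :=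
  (dual_tens3 U V (tens3 W X Y) \o tens_map3 \1 \1 (dual_tens3 W X Y))%VF.

Lemma dual_tens5lE {K : fieldType} {U V W X Y : vectType K} T :
  dual_tens5l K U V W X Y T
  = dual_tens3 (tens3 U V W) X Y (tens_map3 (dual_tens3 U V W) \1 \1 T).
Proof. exact: comp_lfunE. Qed.

Lemma dual_tens5rE {K : fieldType} {U V W X Y : vectType K} T :
  dual_tens5r K U V W X Y T
  = dual_tens3 U V (tens3 W X Y) (tens_map3 \1 \1 (dual_tens3 W X Y) T).
Proof. exact: comp_lfunE. Qed.

(** Both bracketings of five forms and five vectors pair to the same product of
    five scalars. *)
Lemma pairing5_assoc {K : fieldType} {U V W X Y : vectType K}
    (T : tens3 (tens3 (dual U) (dual V) (dual W)) (dual X) (dual Y))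
    (S : tens3 (tens3 U V W) X Y) :
  pairing (dual_tens5r K U V W X Y
             (tens3_assoc (dual U) (dual V) (dual W) (dual X) (dual Y) T))
          (tens3_assoc U V W X Y S)
  = pairing (dual_tens5l K U V W X Y T) S.
Proof.
rewrite -dual_mapE; congr (pairing _ S).
rewrite -(comp_lfunE (dual_tens5r _ _ _ _ _ _)) -(comp_lfunE (dual_map _)).
congr (fun_of_lfun _ T); apply: tens5_ext => xi1 xi2 xi3 xi4 xi5.
rewrite (comp_lfunE (dual_map _)) (comp_lfunE (dual_tens5r _ _ _ _ _ _)).
rewrite tens3_assoc_pure.
apply: dual_tens5_ext => u v w x y.
rewrite dual_mapE tens3_assoc_pure dual_tens5lE dual_tens5rE.
rewrite !tens_map3_pure !id_lfunE !dual_tens3_pure.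
by rewrite !mulrA.
Qed.

Lemma dual_tens5r_inj {K : fieldType} {U V W X Y : vectType K} :
  injective (dual_tens5r K U V W X Y).
Proof.
move=> S T; rewrite !dual_tens5rE => /dual_tens3_inj.
have invK : ((dual_tens3 W X Y)^-1 \o dual_tens3 W X Y)%VF = \1%VF.
  by apply/lker0_compVf/lker0P/dual_tens3_inj.
move=> /(congr1 (tens_map3 \1%VF \1%VF (dual_tens3 W X Y)^-1%VF)).
by rewrite !tens_map3_comp invK !comp_lfun1l !tens_map3_id.
Qed.

(** Reflexivity of [W]: for each [v], the functional [xi |-> F xi v] on
    [dual W] is evaluation at a unique vector of [W], whose coordinates are its
    values on the dual basis. *)
Lemma dual_map_surj {K : fieldType} {V W : vectType K}
    (F : 'Hom(dual W, dual V)) :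
  exists f : 'Hom(V, W), F = dual_map f.
Proof.
pose f v : W := \sum_i pairing (F (dual_e i)) v *: e_ i.
exists (linfun f); apply/lfunP => xi; apply: dual_ext => v.
rewrite dual_mapE linfun_linE; last first.
  move=> a x y; rewrite scaler_sumr -big_split; apply: eq_bigr => i _ /=.
  by rewrite pairingP scalerDl scalerA.
rewrite pairing_sum {1}(sum_dual_e xi) linear_sumZ; last exact: linearP.
by rewrite pairing_suml; apply: eq_bigr => i _; rewrite mulrC.
Qed.

Lemma pairingD {K : fieldType} {V : vectType K} (phi psi : dual V) v :
  pairing (phi + psi) v = pairing phi v + pairing psi v.
Proof. by rewrite -[phi]scale1r pairingPl scale1r mul1r. Qed.

Lemma pairingDr {K : fieldType} {V : vectType K} (phi : dual V) v w :
  pairing phi (v + w) = pairing phi v + pairing phi w.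
Proof. by rewrite -[v]scale1r pairingP scale1r mul1r. Qed.

(** * Dual algebras and coalgebras *)

Lemma dual_comul_tens3 {K : fieldType} {A : vectType K}
    (Delta : 'Hom(A, tens3 A A A)) T :
  dual_comul Delta T = dual_map Delta (dual_tens3 A A A T).
Proof. exact: comp_lfunE. Qed.

Lemma dual_tens3_dual_mul {K : fieldType} {A : vectType K}
    (mu : 'Hom(tens3 A A A, A)) (xi : dual A) :
  dual_tens3 A A A (dual_mul mu xi) = dual_map mu xi.
Proof.
rewrite -[RHS]dual_tens3VK; congr (dual_tens3 A A A _).
exact: comp_lfunE.
Qed.

Lemma dual_comul_assoc {K : fieldType} {A : vectType K}
    {Delta : 'Hom(A, tens3 A A A)} {alpha1 alpha2 : 'End(A)} :
  weak_tot_hom_coassoc Delta alpha1 alpha2 ->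
  weak_tot_hom_assoc (dual_comul Delta) (dual_map alpha1) (dual_map alpha2).
Proof.
move=> coassoc xi1 xi2 xi3 xi4 xi5; apply: dual_ext => x.
rewrite !dual_comul_tens3 !dual_mapE.
set T := pure3 (pure3 xi1 xi2 xi3) xi4 xi5.
have -> : dual_tens3 A A A (pure3
            (dual_map Delta (dual_tens3 A A A (pure3 xi1 xi2 xi3)))
            (dual_map alpha1 xi4) (dual_map alpha2 xi5))
    = dual_map (tens_map3 Delta alpha1 alpha2) (dual_tens5l K A A A A A T).
  rewrite dual_tens5lE -dual_tens3_map !tens_map3_pure.
  by rewrite !id_lfunE.
have -> : dual_tens3 A A A (pure3 (dual_map alpha1 xi1) (dual_map alpha2 xi2)
            (dual_map Delta (dual_tens3 A A A (pure3 xi3 xi4 xi5))))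
    = dual_map (tens_map3 alpha1 alpha2 Delta)
        (dual_tens5r K A A A A A (tens3_assoc _ _ _ _ _ T)).
  rewrite tens3_assoc_pure dual_tens5rE -dual_tens3_map.
  by rewrite !tens_map3_pure !id_lfunE.
rewrite !dual_mapE -pairing5_assoc; congr (pairing _ _).
by move/lfunP: coassoc => /(_ x); rewrite !comp_lfunE.
Qed.

Lemma dual_mul_coassoc {K : fieldType} {A : vectType K}
    {mu : 'Hom(tens3 A A A, A)} {alpha1 alpha2 : 'End(A)} :
  weak_tot_hom_assoc mu alpha1 alpha2 ->
  weak_tot_hom_coassoc (dual_mul mu) (dual_map alpha1) (dual_map alpha2).
Proof.
move=> assoc; apply/lfunP => xi.
rewrite [LHS]comp_lfunE [RHS]comp_lfunE.
rewrite [X in tens3_assoc _ _ _ _ _ X]comp_lfunE.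
have mulK : (dual_tens3 A A A \o dual_mul mu)%VF = dual_map mu.
  by apply/lfunP => eta; rewrite comp_lfunE dual_tens3_dual_mul.
have J5l T : dual_tens5l K A A A A A
      (tens_map3 (dual_mul mu) (dual_map alpha1) (dual_map alpha2) T)
    = dual_map (tens_map3 mu alpha1 alpha2) (dual_tens3 A A A T).
  by rewrite -dual_tens3_map dual_tens5lE tens_map3_comp mulK
             !comp_lfun1l.
have J5r T : dual_tens5r K A A A A A
      (tens_map3 (dual_map alpha1) (dual_map alpha2) (dual_mul mu) T)
    = dual_map (tens_map3 alpha1 alpha2 mu) (dual_tens3 A A A T).
  by rewrite -dual_tens3_map dual_tens5rE tens_map3_comp mulK
             !comp_lfun1l.
apply: dual_tens5r_inj; apply: dual_tens3_ext => x1 x2 S.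
(* The last slot [S] of the test vector is an arbitrary tensor; with [x1] and
   [x2] fixed, both sides are linear forms in [S], so that [S] may be taken
   pure. *)
pose F (phi : dual (tens3 A A (tens3 A A A))) : dual (tens3 A A A) :=
  linfun (fun R : tens3 A A A => pairing phi (pure3 x1 x2 R) : K^o).
have FE phi R : pairing (F phi) R = pairing phi (pure3 x1 x2 R).
  rewrite /pairing /F linfun_linE // => a s t.
  by rewrite /pure3 !purePr pairingP.
rewrite -!FE; congr (pairing _ S); apply: dual_tens3_ext => x3 x4 x5.
rewrite !FE -tens3_assoc_pure pairing5_assoc tens3_assoc_pure J5l J5r.
rewrite !dual_mapE dual_tens3_dual_mul !dual_mapE !tens_map3_pure.
by rewrite assoc.
Qed.

(** Moving the translation by fixed vectors from one side of the pairing to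
    the other turns [L] into [R], [M] into [M], and [R] into [L].  The sought
    identity is thus [inf_compat] paired with [xi (x) eta (x) gamma], with its
    first and third summands exchanged. *)
Lemma dual_inf_compat {K : fieldType} {A : vectType K}
    {mu : 'Hom(tens3 A A A, A)} {Delta : 'Hom(A, tens3 A A A)}
    {alpha1 alpha2 : 'End(A)} :
  inf_compat mu Delta alpha1 alpha2 ->
  inf_compat (dual_comul Delta) (dual_mul mu)
    (dual_map alpha1) (dual_map alpha2).
Proof.
move=> compat xi eta gamma; apply: dual_tens3_inj; apply: dual_tens3_ext.
move=> x y z.
have termL : pairing (dual_tens3 A A A
      (tens_map3 (ternL (dual_comul Delta)
                    (dual_map alpha1 xi) (dual_map alpha2 eta))
         (dual_map alpha1) (dual_map alpha2) (dual_mul mu gamma)))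
      (pure3 x y z)
    = pairing (dual_tens3 A A A (pure3 xi eta gamma))
        (tens_map3 alpha1 alpha2 (ternR mu (alpha1 y) (alpha2 z)) (Delta x)).
  (* Up to the twists, [f] contracts [Delta x] with [xi] and [eta]. *)
  have [f fE] := dual_map_surj (ternL (dual_comul Delta)
                   (dual_map alpha1 xi) (dual_map alpha2 eta)).
  rewrite fE dual_tens3_map dual_tens3_dual_mul !dual_mapE tens_map3_pure.
  rewrite -ternRE -!dual_mapE -fE ternLE dual_comul_tens3.
  by rewrite -tens_map3_pure dual_tens3_map.
have termM : pairing (dual_tens3 A A A
      (tens_map3 (dual_map alpha1)
         (ternM (dual_comul Delta)
            (dual_map alpha1 xi) (dual_map alpha2 gamma))
         (dual_map alpha2) (dual_mul mu eta)))
      (pure3 x y z)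
    = pairing (dual_tens3 A A A (pure3 xi eta gamma))
        (tens_map3 alpha1 (ternM mu (alpha1 x) (alpha2 z)) alpha2 (Delta y)).
  have [f fE] := dual_map_surj (ternM (dual_comul Delta)
                   (dual_map alpha1 xi) (dual_map alpha2 gamma)).
  rewrite fE dual_tens3_map dual_tens3_dual_mul !dual_mapE tens_map3_pure.
  rewrite -ternME -!dual_mapE -fE ternME dual_comul_tens3.
  by rewrite -tens_map3_pure dual_tens3_map.
have termR : pairing (dual_tens3 A A A
      (tens_map3 (dual_map alpha1) (dual_map alpha2)
         (ternR (dual_comul Delta)
            (dual_map alpha1 eta) (dual_map alpha2 gamma))
         (dual_mul mu xi)))
      (pure3 x y z)
    = pairing (dual_tens3 A A A (pure3 xi eta gamma))
        (tens_map3 (ternL mu (alpha1 x) (alpha2 y)) alpha1 alpha2 (Delta z)).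
  have [f fE] := dual_map_surj (ternR (dual_comul Delta)
                   (dual_map alpha1 eta) (dual_map alpha2 gamma)).
  rewrite fE dual_tens3_map dual_tens3_dual_mul !dual_mapE tens_map3_pure.
  rewrite -ternLE -!dual_mapE -fE ternRE dual_comul_tens3.
  by rewrite -tens_map3_pure dual_tens3_map.
rewrite !linearD !pairingD termL termM termR.
rewrite dual_tens3_dual_mul dual_mapE dual_comul_tens3 dual_mapE compat.
by rewrite !pairingDr [RHS]addrC addrA [RHS]addrAC.
Qed.

Theorem theorem4p13 (K : fieldType) (charK : [pchar K] =i pred0)
    (A : vectType K)
    (mu : 'Hom(tens3 A A A, A)) (Delta : 'Hom(A, tens3 A A A))
    (alpha1 alpha2 : 'End(A)) :
  weak_tot_hom_assoc_inf_bialg mu Delta alpha1 alpha2 ->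
  weak_tot_hom_assoc_inf_bialg (dual_comul Delta) (dual_mul mu)
    (dual_map alpha1) (dual_map alpha2).
Proof.
by case=> /dual_mul_coassoc ? /dual_comul_assoc ? /dual_inf_compat ?; split.
Qed.
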